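(* Let $X$ be an infinite compact Hausdorff space, let $\sigma:X\to X$ be a minimal homeomorphism, and let $Z\subseteq Y\subseteq X$ where each of $Y$ and $Z$ is the closure of a nonempty open subset of $X$. Let $A_Y\subseteq A_Z$ be the associated orbit breaking subalgebras of $C(X)\rtimes_\sigma\mathbb{Z}$ and let $\phi:A_Y\to A_Z$ be the inclusion. Then, with respect to the presentations $\iota_Y,\iota_Z$ of $A_Y$ and $A_Z$ as diagonal subhomogeneous (DSH) algebras described in the context, $\phi$ is a diagonal map between DSH algebras.
   Context: Orbit breaking algebras. $C(X)\rtimes_\sigma\mathbb{Z}$ is generated by $C(X)$ and a unitary $u$ with $ufu^*=f\circ\sigma^{-1}$. For a closed set $Y\subseteq X$, $A_Y$ is the $C^*$-subalgebra generated by $\{f,\,ug: f,g\in C(X),\ g|_Y=0\}$. If $Z\subseteq Y$ then $A_Y\subseteq A_Z$. Presentation of $A_Y$. For $Y$ the closure of a nonempty open set and $y\in Y$, let $R(y)=\min\{n>0:\sigma^n(y)\in Y\}$ (first return time). $R(Y)$ is a finite set $\{n_1<\dots<n_l\}$. Put $X_i=\overline{R^{-1}(n_i)}$ and $Y_i=X_i\setminus R^{-1}(n_i)$. Then $A_Y$ is identified with a subalgebra of $\bigoplus_{i=1}^lC(X_i,M_{n_i})$ via the map $\iota_Y$ determined, for $y\in X_i$, by $\iota_Y(f)_i(y)=\mathrm{diag}(f(\sigma(y)),\dots,f(\sigma^{n_i}(y)))$ for $f\in C(X)$, and, for $g\in C(X)$ with $g|_Y=0$, $\iota_Y(ug)_i(y)$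 is the $n_i\times n_i$ matrix whose $(m+1,m)$ entry is $g(\sigma^m(y))$ for $1\le m\le n_i-1$ and whose other entries are $0$. This exhibits $A_Y$ as a DSH algebra with spaces $X_i$, closed subspaces $Y_i$ and dimensions $n_i$. The presentation $\iota_Z$ of $A_Z$ is obtained in the same way from $Z$. DSH algebras. Suppose given compact Hausdorff spaces $X_1,\dots,X_l$, closed subspaces $Y_i\subseteq X_i$ (with $Y_1=\varnothing$), positive integers $n_1,\dots,n_l$, $C^*$-algebras $A^{(i)}\subseteq\bigoplus_{j=1}^i C(X_j,M_{n_j})$ with $A^{(1)}=C(X_1,M_{n_1})$, and homomorphisms $\psi_i:A^{(i)}\to C(Y_{i+1},M_{n_{i+1}})$ for $1\le i\le l-1$, such that: (a) for each $y\in Y_{i+1}$ there are points $x_1,\dots,x_t$ with $x_m\in X_{i_m}$, $i_m\le i$, such that $\psi_i(f)(y)=\mathrm{diag}(f_{i_1}(x_1),\dots,f_{i_t}(x_t))$ for all $f\in A^{(i)}$, where $f_r$ is the summand of $f$ in $C(X_r,M_{n_r})$; (b) $A^{(i+1)}=\{(a,g)\in A^{(i)}\oplus C(X_{i+1},M_{n_{i+1}}):\psi_i(a)=g|_{Y_{i+1}}\}$. Then $A^{(l)}$ is called diagonal subhomogeneous (DSH). Diagonal maps. Let $A\subseteq\bigoplus_i C(X_i,M_{n_i})$ and $A'\subseteq\bigoplus_i C(X_i',M_{n_i'})$ be DSH algebras. A homomorphism $\phi:A\to A'$ is diagonal if for every $i$ and every $x\in X_i'$ there are points $x_1,\dots,x_t$,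 $x_k\in X_{i_k}$, such that $\phi(f)_i(x)=\mathrm{diag}(f_{i_1}(x_1),\dots,f_{i_t}(x_t))$ for every $f\in A$. *)

(* Defs.v *)
From HB Require Import structures.
From mathcomp Require Import all_boot all_order all_algebra complex.
From mathcomp Require Import all_classical all_reals all_analysis.

Set Implicit Arguments.
Unset Strict Implicit.
Unset Printing Implicit Defensive.

Import Order.TTheory GRing.Theory Num.Theory numFieldNormedType.Exports.

Local Open Scope classical_set_scope.
Local Open Scope ring_scope.

(* The complex numbers over [R], typed so that the topology of a numeric field
   is found on them. *)
Definition Cplx (R : realType) : numClosedFieldType := R[i]%C.

Reserved Notation "a ** b" (at level 40, left associativity).

(* *-algebras, possibly zero or without unit.  They are built on [lmodType]
   with a product of their own: [algType] requires 1 != 0, which fails for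
   functions on an empty space, and MathComp has no common extension of its
   rings and of the normed modules of MathComp-Analysis. *)
HB.mixin Record isStarAlgebra (K : numClosedFieldType) A
    of GRing.Lmodule K A := {
  smul : A -> A -> A ;
  star : A -> A ;
  smulA : associative smul ;
  smulDl : left_distributive smul +%R ;
  smulDr : right_distributive smul +%R ;
  smulZl : forall (c : K) (a b : A), smul (c *: a) b = c *: smul a b ;
  smulZr : forall (c : K) (a b : A), smul a (c *: b) = c *: smul a b ;
  starK : involutive star ;
  starD : {morph star : a b / a + b} ;
  starM : forall a b, star (smul a b) = smul (star b) (star a) ;
  starZ : forall (c : K) a, star (c *: a) = c^* *: star a
}.

#[short(type="starAlgType")]
HB.structure Definition StarAlgebra (K : numClosedFieldType) :=
  {A of GRing.Lmodule K A & isStarAlgebra K A}.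

Notation "a ** b" := (smul a b) : ring_scope.

HB.mixin Record isCStarAlgebra (K : numClosedFieldType) A
    of StarAlgebra K A & CompleteNormedModule K A := {
  cstar_normM : forall a b : A, `|a ** b| <= `|a| * `|b| ;
  cstar_norm : forall a : A, `|star a ** a| = `|a| ^+ 2
}.

#[short(type="cstarAlgType")]
HB.structure Definition CStarAlgebra (K : numClosedFieldType) :=
  {A of StarAlgebra K A & CompleteNormedModule K A & isCStarAlgebra K A}.

Section star_subalgebras.
Context (K : numClosedFieldType).

Record star_subalgebra (A : starAlgType K) (S : set A) : Prop := {
  star_sub0 : S 0 ;
  star_subD : forall a b, S a -> S b -> S (a + b) ;
  star_subZ : forall (c : K) a, S a -> S (c *: a) ;
  star_subM : forall a b, S a -> S b -> S (a ** b) ;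
  star_subS : forall a, S a -> S (star a) }.

Record star_hom (A B : starAlgType K) (S : set A) (f : A -> B) : Prop := {
  star_homD : forall a b, S a -> S b -> f (a + b) = f a + f b ;
  star_homZ : forall (c : K) a, S a -> f (c *: a) = c *: f a ;
  star_homM : forall a b, S a -> S b -> f (a ** b) = f a ** f b ;
  star_homS : forall a, S a -> f (star a) = star (f a) }.

Definition is_unit_elt (A : starAlgType K) (e : A) : Prop :=
  forall a, e ** a = a /\ a ** e = a.

Definition cstar_generated (B : cstarAlgType K) (G : set B) : set B :=
  smallest [set S : set B | star_subalgebra S /\ closed S] G.

End star_subalgebras.

Section star_instances.
Context (K : numClosedFieldType).

Let regZl (c : K) (a b : K^o) : (c *: a) * b = c *: (a * b).
Proof. by rewrite -mulrA. Qed.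
Let regZr (c : K) (a b : K^o) : a * (c *: b) = c *: (a * b).
Proof. exact: mulrCA. Qed.
Let regM (a b : K^o) : (a * b)^* = b^* * a^* :> K^o.
Proof. by rewrite rmorphM mulrC. Qed.

HB.instance Definition _ := isStarAlgebra.Build K K^o
  (@mulrA K) (@mulrDl K) (@mulrDr K) regZl regZr
  (@conjCK K) (rmorphD Num.conj) regM (rmorphM Num.conj).

Let adjmx n (a : 'M[K]_n) : 'M[K]_n := map_mx Num.conj a^T.

Let mxZl n (c : K) (a b : 'M[K]_n) : (c *: a) *m b = c *: (a *m b).
Proof. by rewrite scalemxAl. Qed.
Let mxZr n (c : K) (a b : 'M[K]_n) : a *m (c *: b) = c *: (a *m b).
Proof. by rewrite scalemxAr. Qed.
Let adjmxK n : involutive (@adjmx n).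
Proof. by move=> a; apply/matrixP => p q; rewrite !mxE conjCK. Qed.
Let adjmxD n : {morph @adjmx n : a b / a + b}.
Proof. by move=> a b; apply/matrixP => p q; rewrite !mxE rmorphD. Qed.
Let adjmxM n (a b : 'M[K]_n) : adjmx (a *m b) = adjmx b *m adjmx a.
Proof. by rewrite /adjmx trmx_mul map_mxM. Qed.
Let adjmxZ n (c : K) (a : 'M[K]_n) : adjmx (c *: a) = c^* *: adjmx a.
Proof. by apply/matrixP => p q; rewrite !mxE rmorphM. Qed.

HB.instance Definition _ n := isStarAlgebra.Build K 'M[K]_n
  (@mulmxA _ n n n n) (@mulmxDl _ n n n) (@mulmxDr _ n n n)
  (@mxZl n) (@mxZr n)
  (@adjmxK n) (@adjmxD n) (@adjmxM n) (@adjmxZ n).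

Section fct.
Context (T : Type) (A : starAlgType K).

Let fct_mul (f g : T -> A) : T -> A := fun x => f x ** g x.
Let fct_star (f : T -> A) : T -> A := fun x => star (f x).

Let fct_mulA : associative fct_mul.
Proof. by move=> *; apply/funext => x; rewrite /fct_mul/= smulA. Qed.
Let fct_mulDl : left_distributive fct_mul +%R.
Proof. by move=> *; apply/funext => x; rewrite /fct_mul/= smulDl. Qed.
Let fct_mulDr : right_distributive fct_mul +%R.
Proof. by move=> *; apply/funext => x; rewrite /fct_mul/= smulDr. Qed.
Let fct_mulZl (c : K) (f g : T -> A) : fct_mul (c *: f) g = c *: fct_mul f g.
Proof. by apply/funext => x; rewrite /fct_mul/= smulZl. Qed.
Let fct_mulZr (c : K) (f g : T -> A) : fct_mul f (c *: g) = c *: fct_mul f g.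
Proof. by apply/funext => x; rewrite /fct_mul/= smulZr. Qed.
Let fct_starK : involutive fct_star.
Proof. by move=> *; apply/funext => x; rewrite /fct_star/= starK. Qed.
Let fct_starD : {morph fct_star : f g / f + g}.
Proof. by move=> *; apply/funext => x; rewrite /fct_star/= starD. Qed.
Let fct_starM (f g : T -> A) :
  fct_star (fct_mul f g) = fct_mul (fct_star g) (fct_star f).
Proof. by apply/funext => x; rewrite /fct_star/= starM. Qed.
Let fct_starZ (c : K) (f : T -> A) : fct_star (c *: f) = c^* *: fct_star f.
Proof. by apply/funext => x; rewrite /fct_star/= starZ. Qed.

HB.instance Definition _ := isStarAlgebra.Build K (T -> A)
  fct_mulA fct_mulDl fct_mulDr fct_mulZl fct_mulZr
  fct_starK fct_starD fct_starM fct_starZ.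
End fct.
End star_instances.

(* All families [a] of functions [a i : T i -> 'M_(n i)], with the pointwise
   operations; the direct sum of the [C(T i, M_(n i))] is the subset
   [csum xpredT] below. *)
Definition mfsum (K : numClosedFieldType) (l : nat)
  (T : 'I_l -> topologicalType) (n : 'I_l -> nat) : Type := forall i : 'I_l, T i -> 'M[K]_(n i).

Section mfsum_instances.
Context (K : numClosedFieldType) (l : nat) (T : 'I_l -> topologicalType)
  (n : 'I_l -> nat).
Local Notation M := (mfsum K T n).

HB.instance Definition _ := gen_eqMixin M.
HB.instance Definition _ := gen_choiceMixin M.

Let ext (a b : M) : (forall i x, a i x = b i x) -> a = b.
Proof. by move=> ab; apply: functional_extensionality_dep => i; apply/funext. Qed.

Let zero : M := fun _ _ => 0.
Let opp (a : M) : M := fun i x => - a i x.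
Let add (a b : M) : M := fun i x => a i x + b i x.
Let scale (c : K) (a : M) : M := fun i x => c *: a i x.
Let mul (a b : M) : M := fun i x => a i x ** b i x.
Let mstar (a : M) : M := fun i x => star (a i x).

Let addA : associative add.
Proof. by move=> *; apply: ext => *; exact: addrA. Qed.
Let addC : commutative add.
Proof. by move=> *; apply: ext => *; exact: addrC. Qed.
Let add0 : left_id zero add.
Proof. by move=> *; apply: ext => *; exact: add0r. Qed.
Let addN : left_inverse zero opp add.
Proof. by move=> *; apply: ext => *; exact: addNr. Qed.

HB.instance Definition _ := GRing.isZmodule.Build M addA addC add0 addN.

Let scaleA c d a : scale c (scale d a) = scale (c * d) a.
Proof. by apply: ext => *; exact: scalerA. Qed.
Let scale1 : left_id 1 scale.
Proof. by move=> *; apply: ext => *; exact: scale1r. Qed.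
Let scaleDr : right_distributive scale +%R.
Proof. by move=> *; apply: ext => *; exact: scalerDr. Qed.
Let scaleDl a : {morph scale^~ a : c d / c + d}.
Proof. by move=> *; apply: ext => *; exact: scalerDl. Qed.

HB.instance Definition _ :=
  GRing.Zmodule_isLmodule.Build K M scaleA scale1 scaleDr scaleDl.

Let mulA : associative mul.
Proof. by move=> *; apply: ext => i x; rewrite /mul/= smulA. Qed.
Let mulDl : left_distributive mul +%R.
Proof. by move=> *; apply: ext => i x; rewrite /mul/= smulDl. Qed.
Let mulDr : right_distributive mul +%R.
Proof. by move=> *; apply: ext => i x; rewrite /mul/= smulDr. Qed.
Let mulZl (c : K) (a b : M) : mul (c *: a) b = c *: mul a b.
Proof. by apply: ext => i x; rewrite /mul/= smulZl. Qed.
Let mulZr (c : K) (a b : M) : mul a (c *: b) = c *: mul a b.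
Proof. by apply: ext => i x; rewrite /mul/= smulZr. Qed.
Let mstarK : involutive mstar.
Proof. by move=> *; apply: ext => i x; rewrite /mstar/= starK. Qed.
Let mstarD : {morph mstar : a b / a + b}.
Proof. by move=> *; apply: ext => i x; rewrite /mstar/= starD. Qed.
Let mstarM (a b : M) : mstar (mul a b) = mul (mstar b) (mstar a).
Proof. by apply: ext => i x; rewrite /mstar/= starM. Qed.
Let mstarZ (c : K) (a : M) : mstar (c *: a) = c^* *: mstar a.
Proof. by apply: ext => i x; rewrite /mstar/= starZ. Qed.

HB.instance Definition _ := isStarAlgebra.Build K M
  mulA mulDl mulDr mulZl mulZr mstarK mstarD mstarM mstarZ.

(* The direct sum of the [C(T i, M_(n i))] over the [i] satisfying [P]. *)
Definition csum (P : pred 'I_l) : set M :=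
  [set a : M | (forall i, continuous (a i)) /\ (forall i, ~~ P i -> a i = 0)].

Definition mtrunc (P : pred 'I_l) (a : M) : M := fun i => if P i then a i else 0.

(* The largest absolute value of an entry is a norm equivalent to the C*-norm
   on the direct sum, so this is closedness in the C*-norm. *)
Definition unif_closed (A : set M) : Prop :=
  forall a : M, (forall i, continuous (a i)) ->
    (forall e : K, 0 < e -> exists2 b : M, A b &
       forall i x p q, `|a i x p q - b i x p q| < e) -> A a.

End mfsum_instances.

Section dsh.
Context (K : numClosedFieldType).

(* [ev a = diag(a (x_1), .., a (x_t))] for all [a] in [A], for fixed points
   [x_k] lying in the spaces [T i] with [P i]. *)
Definition diagonal_on l (T : 'I_l -> topologicalType) (n : 'I_l -> nat)
    (A : set (mfsum K T n)) (P : pred 'I_l) m (ev : mfsum K T n -> 'M[K]_m) :=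
  exists (t : nat) (x : 'I_t -> {i : 'I_l & T i})
         (e : (\sum_(k < t) n (tag (x k)))%N = m),
    (forall k, P (tag (x k))) /\
    forall a, A a ->
      ev a = castmx (e, e) (\mxdiag_(k < t) a (tag (x k)) (tagged (x k))).

(* Indices start at 0.  [stage i] is A^(i+1), seen inside the full direct sum
   by setting the summands of index > i to 0.  [psi k], for k = i+1, is the
   homomorphism from [stage i] into C(Y k, M_(n k)). *)
Definition dsh_tower l (T : 'I_l -> topologicalType) (Y : forall i, set (T i))
    (n : 'I_l -> nat) (stage : 'I_l -> set (mfsum K T n))
    (psi : forall k : 'I_l, mfsum K T n -> set_type (Y k) -> 'M[K]_(n k)) :=
  [/\ forall i, [/\ stage i `<=` csum (fun j => (j <= i)%N),
                    star_subalgebra (stage i) & unif_closed (stage i)],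
      forall i : 'I_l, i = 0%N :> nat -> stage i = csum (fun j => (j <= i)%N),
      forall i k : 'I_l, k = i.+1 :> nat ->
        [/\ star_hom (stage i) (psi k),
            forall a, stage i a -> continuous (psi k a) &
            forall y, diagonal_on (stage i) (fun j => (j <= i)%N)
                        (fun a => psi k a y)] &
      forall i k : 'I_l, k = i.+1 :> nat ->
        stage k = [set a | [/\ csum (fun j => (j <= k)%N) a,
                               stage i (mtrunc (fun j => (j <= i)%N) a) &
                               forall y, psi k (mtrunc (fun j => (j <= i)%N) a) y
                                         = a k (set_val y)]]].

Record is_DSH l (T : 'I_l -> topologicalType) (Y : forall i, set (T i))
    (n : 'I_l -> nat) (A : set (mfsum K T n)) : Prop := {
  dsh_length : (0 < l)%N ;
  dsh_compact : forall i, compact [set: T i] ;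
  dsh_hausdorff : forall i, hausdorff_space (T i) ;
  dsh_closed : forall i, closed (Y i) ;
  dsh_Y0 : forall i : 'I_l, i = 0%N :> nat -> Y i = set0 ;
  dsh_dim : forall i, (0 < n i)%N ;
  dsh_stages : exists stage psi, @dsh_tower l T Y n stage psi /\
     forall i : 'I_l, i.+1 = l -> stage i = A }.

Record diagonal_map l (T : 'I_l -> topologicalType) (n : 'I_l -> nat)
    (A : set (mfsum K T n)) l' (T' : 'I_l' -> topologicalType) (n' : 'I_l' -> nat)
    (A' : set (mfsum K T' n')) (phi : mfsum K T n -> mfsum K T' n') : Prop := {
  diagonal_map_sub : forall a, A a -> A' (phi a) ;
  diagonal_map_hom : star_hom A phi ;
  diagonal_map_diag : forall i (x : T' i),
    diagonal_on A xpredT (fun a => phi a i x) }.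

End dsh.

Section dynamics.
Context (X : topologicalType).

Record homeomorphism (sigma sigmaV : X -> X) : Prop := {
  homeo_can : cancel sigma sigmaV ;
  homeo_canV : cancel sigmaV sigma ;
  homeo_cont : continuous sigma ;
  homeo_contV : continuous sigmaV }.

Definition minimal_map (sigma : X -> X) : Prop :=
  forall F : set X, closed F -> sigma @` F = F -> F = set0 \/ F = setT.

Definition closure_of_open (Y : set X) : Prop :=
  exists U : set X, [/\ open U, U !=set0 & Y = closure U].

(* The level set [R^-1(r)] of the first return time R to Y. *)
Definition return_level (sigma : X -> X) (Y : set X) (r : nat) : set X :=
  [set y | [/\ Y y, (0 < r)%N, Y (iter r sigma y) &
               forall m, (0 < m < r)%N -> ~ Y (iter m sigma y)]].

(* [n] is the increasing enumeration of R(Y). *)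
Definition return_times (sigma : X -> X) (Y : set X) l (n : 'I_l -> nat) : Prop :=
  (forall i j : 'I_l, (i < j)%N -> (n i < n j)%N) /\
  range n = [set r | return_level sigma Y r !=set0].

Definition return_space (sigma : X -> X) (Y : set X) l (n : 'I_l -> nat)
    (i : 'I_l) : topologicalType :=
  set_type (closure (return_level sigma Y (n i))).

Definition return_boundary (sigma : X -> X) (Y : set X) l (n : 'I_l -> nat)
    (i : 'I_l) : set (return_space sigma Y n i) :=
  [set y | ~ return_level sigma Y (n i) (set_val y)].

End dynamics.

Section crossed_product.
Context (K : numClosedFieldType) (X : topologicalType).
Implicit Types (B : cstarAlgType K).

Definition cfun : set (X -> K^o) := [set f | continuous f].

Record covariant_rep (sigmaV : X -> X) B (j : (X -> K^o) -> B) (u : B)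
    : Prop := {
  covariant_hom : star_hom cfun j ;
  covariant_unital : is_unit_elt (j (fun=> 1)) ;
  covariant_unitary : star u ** u = j (fun=> 1) /\ u ** star u = j (fun=> 1) ;
  covariant_conj : forall f, cfun f -> u ** j f ** star u = j (f \o sigmaV) }.

(* (B, j, u) is the crossed product of C(X) by Z: the universal C*-algebra
   generated by C(X) and a unitary implementing sigma. *)
Record is_crossed_product (sigmaV : X -> X) B (j : (X -> K^o) -> B) (u : B)
    : Prop := {
  crossed_covariant : covariant_rep sigmaV j u ;
  crossed_generated : cstar_generated (j @` cfun `|` [set u]) = setT ;
  crossed_universal : forall (D : cstarAlgType K) (pi : (X -> K^o) -> D) (v : D),
    covariant_rep sigmaV pi v ->
    exists Phi : B -> D, [/\ star_hom setT Phi,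
      forall f, cfun f -> Phi (j f) = pi f & Phi u = v] }.

Definition orbit_breaking B (j : (X -> K^o) -> B) (u : B) (Y : set X) : set B :=
  cstar_generated (j @` cfun `|`
    [set u ** j g | g in [set g | cfun g /\ forall y, Y y -> g y = 0]]).

(* With indices starting at 0, the entry (q+1, q) of the second matrix is
   g(sigma^(q+1) y). *)
Record is_presentation (sigma : X -> X) B (j : (X -> K^o) -> B) (u : B)
    (Y : set X) l (n : 'I_l -> nat)
    (iota : B -> mfsum K (return_space sigma Y n) n) : Prop := {
  pres_times : return_times sigma Y n ;
  pres_hom : star_hom (orbit_breaking j u Y) iota ;
  pres_inj : {in orbit_breaking j u Y &, injective iota} ;
  pres_fun : forall f, cfun f -> forall i (y : return_space sigma Y n i),
    iota (j f) i y = diag_mx (\row_p f (iter p.+1 sigma (set_val y))) ;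
  pres_shift : forall g, cfun g -> (forall y, Y y -> g y = 0) ->
    forall i (y : return_space sigma Y n i),
    iota (u ** j g) i y =
      \matrix_(p, q) (if p == q.+1 :> nat
                      then g (iter q.+1 sigma (set_val y)) else 0) ;
  pres_DSH : is_DSH (@return_boundary X sigma Y l n)
               (iota @` orbit_breaking j u Y) }.

End crossed_product.

(* Main.v *)
Require Import Defs.
From HB Require Import structures.
From mathcomp Require Import all_boot all_order all_algebra complex.
From mathcomp Require Import all_classical all_reals all_analysis.
From mathcomp Require Import ring.
Import Order.TTheory GRing.Theory Num.Theory numFieldNormedType.Exports.
Local Open Scope classical_set_scope.
Local Open Scope ring_scope.

(** Fix a point [x] in the closure of the set of points of [Z] that return to [Z]
    for the first time after [n] steps.  The claim is that [iotaZ b] at [x], for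
    [b] in [A_Y], is block diagonal, with blocks the values of [iotaY b] at fixed
    points.

    When [x] itself first returns to [Z] after [n] steps, its orbit segment up to
    time [n] starts and ends in [Y], because [Z] is contained in [Y], and its
    visits to [Y] cut it into first-return segments of [Y].  The blocks are
    indexed by these segments and evaluated at the points where they start.  A
    general [x] is a limit of such points; their ways of cutting [n] are finite
    in number, so one of them occurs arbitrarily near [x], and by continuity the
    corresponding points of the orbit of [x] lie in the closures of the right
    return levels ([closure_itinerary]).

    On a function [f] the two diagonal matrices agree entry by entry
    ([mxdiag_orbit_fun]).  On [u g] with [g] zero on [Y], the subdiagonal entries
    that fall outside the blocks are values of [g] at visits to [Y], hence zero
    ([mxdiag_orbit_shift]).  Both sides are star-homomorphisms in [b], so they
    agree on the star-algebra generated by these elements.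

    Passing to its closure requires that star-homomorphisms from a C*-algebra to
    matrices be continuous ([star_hom_entry_le]).  An eigenvalue of the image of
    [a] exceeding the norm of [a] contradicts the convergence of a Neumann
    series, and the trace of the image of [a^* a] is both the sum of its
    eigenvalues and the sum of the squared absolute values of the entries of the
    image of [a]. *)

Set Implicit Arguments.
Unset Strict Implicit.
Unset Printing Implicit Defensive.

(** * Star-subalgebras and star-homomorphisms *)

Section star_algebra_facts.
Context (K : numClosedFieldType).

Lemma smulBr (A : starAlgType K) (a b c : A) : a ** (b - c) = a ** b - a ** c.
Proof. by rewrite smulDr -[- c]scaleN1r smulZr scaleN1r. Qed.

Lemma star_subB (A : starAlgType K) (S : set A) (a b : A) :
  star_subalgebra S -> S a -> S b -> S (a - b).
Proof.
move=> hS Sa Sb; rewrite -[- b]scaleN1r.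
by apply: (star_subD hS) => //; apply: (star_subZ hS).
Qed.

Lemma star_homB (A B : starAlgType K) (S : set A) (f : A -> B) (a b : A) :
  star_subalgebra S -> star_hom S f -> S a -> S b -> f (a - b) = f a - f b.
Proof.
move=> hS hf Sa Sb; rewrite -[- b]scaleN1r -[- f b]scaleN1r.
rewrite (star_homD hf) ?(star_homZ hf)//.
exact: (star_subZ hS).
Qed.

Lemma cstar_generated_star_subalgebra (B : cstarAlgType K) (G : set B) :
  star_subalgebra (cstar_generated G).
Proof.
split=> [|a b Ga Gb|c a Ga|a b Ga Gb|a Ga] S [[hS cS] GS].
- exact: (star_sub0 hS).
- by apply: (star_subD hS); [apply: Ga|apply: Gb].
- by apply: (star_subZ hS); apply: Ga.
- by apply: (star_subM hS); [apply: Ga|apply: Gb].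
- by apply: (star_subS hS); apply: Ga.
Qed.

Lemma cstar_generated_closed (B : cstarAlgType K) (G : set B) :
  closed (cstar_generated G).
Proof. by apply: closed_bigI => S [[]]. Qed.

Lemma sub_cstar_generated (B : cstarAlgType K) (G : set B) :
  G `<=` cstar_generated G.
Proof. exact: sub_smallest. Qed.

Lemma cstar_generated_min (B : cstarAlgType K) (G S : set B) :
  star_subalgebra S -> closed S -> G `<=` S -> cstar_generated G `<=` S.
Proof. by move=> hS cS; apply: smallest_sub. Qed.

Lemma star_hom_sub (A C : starAlgType K) (S S' : set A) (f : A -> C) :
  S' `<=` S -> star_hom S f -> star_hom S' f.
Proof.
move=> sS h; split=> [a b /sS ? /sS ?|c a /sS ?|a b /sS ? /sS ?|a /sS ?].
- exact: (star_homD h).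
- exact: (star_homZ h).
- exact: (star_homM h).
- exact: (star_homS h).
Qed.

Lemma star_hom_eval (B : starAlgType K) (S : set B) l (T : 'I_l -> topologicalType)
    (n : 'I_l -> nat) (iota : B -> mfsum K T n) i (y : T i) :
  star_hom S iota -> star_hom S (fun b => iota b i y : 'M[K]_(n i)).
Proof.
move=> h; split=> [a b Sa Sb|c a Sa|a b Sa Sb|a Sa].
- by rewrite (star_homD h).
- by rewrite (star_homZ h).
- by rewrite (star_homM h).
- by rewrite (star_homS h).
Qed.

End star_algebra_facts.

(** * Star-homomorphisms into matrices are continuous *)

(** The norm of a complex normed space takes its values in the scalar field
    itself, and an abstract algebraically closed numeric field need not be
    archimedean.  This is the one archimedean fact that the Neumann series
    below requires; [M] is the constant of a geometric estimate. *)
Definition geometric_vanishing (K : numClosedFieldType) : Prop :=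
  forall q M e : K, 0 <= q < 1 -> 0 <= M -> 0 < e ->
  exists N, forall n, (N <= n)%N -> q ^+ n * M < e.

Lemma geometric_vanishing_Cplx (R : realType) : geometric_vanishing (Cplx R).
Proof.
move=> q M e.
have key (x : Cplx R) : 0 <= x -> exists2 r : R, 0 <= r & x = real_complex R r.
  move=> x0; have /complex_realP[r xr] := ger0_real x0.
  by exists r => //; rewrite xr ler0c in x0.
move=> /andP[/key[r r0 ->] +] /key[m m0 ->] e0.
have [d d0 ed] := key _ (ltW e0); rewrite ed in e0 *.
have -> : 1 = real_complex R 1 by [].
rewrite ltcR => r1; move: e0; have -> : 0 = real_complex R 0 by [].
rewrite ltcR => {}d0.
have dm : 0 < d / (m + 1) by rewrite divr_gt0// ltr_wpDl.
have := @cvg_expr R r; rewrite ger0_norm// => /(_ r1).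
move=> /cvgr0Pnorm_lt/(_ _ dm)[N _ hN]; exists N => n /hN.
rewrite /= ger0_norm ?exprn_ge0// ltr_pdivlMr ?ltr_wpDl// => h.
rewrite -rmorphXn -rmorphM ltcR; apply: le_lt_trans h.
by rewrite ler_wpM2l ?exprn_ge0// lerDl.
Qed.

Section automatic_continuity.
Context (K : numClosedFieldType).
Context (B : cstarAlgType K) (S : set B).
Hypothesis geo : geometric_vanishing K.
Hypotheses (hS : star_subalgebra S) (cS : closed S).

(** [b] is the sum of the powers [c^k], [k >= 1].  Since the algebra may lack a
    unit, this replaces the inverse of [1 - c]; the partial sums are the
    iterates of the contraction [b |-> c + c ** b]. *)
Lemma neumann_fixpoint (c : B) : S c -> `|c| < 1 ->
  exists2 b, S b & b = c + c ** b.
Proof.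
move=> Sc c1; set q := `|c|; have q0 : 0 <= q by exact: normr_ge0.
pose s n := iter n (fun b => c + c ** b) 0.
have Ss n : S (s n).
  by elim: n => [|n IH]; [apply: (star_sub0 hS)|
    apply: (star_subD hS) => //; apply: (star_subM hS)].
have q1 : 0 < 1 - q by rewrite subr_gt0.
pose M := q / (1 - q); have M0 : 0 <= M by rewrite divr_ge0// ltW.
have sM n : `|s n| <= M.
  elim: n => [|n IH] /=; first by rewrite normr0.
  apply: (le_trans (ler_normD _ _)).
  have -> : M = q + q * M by rewrite /M; field; rewrite gt_eqF.
  rewrite lerD2l; apply: (le_trans (cstar_normM _ _)).
  by rewrite ler_wpM2l.
(* Consecutive tails shrink by [q], starting from the bound [M] on them all. *)
have sC n k : `|s n - s (n + k)%N| <= q ^+ n * M.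
  elim: n => [|n IH]; first by rewrite expr0 mul1r sub0r normrN; exact: sM.
  rewrite addSn /= opprD addrACA subrr add0r -smulBr exprS -mulrA.
  by apply: (le_trans (cstar_normM _ _)); rewrite ler_wpM2l.
have qq : 0 <= q < 1 by rewrite q0.
have small e : 0 < e ->
    exists N, forall n, (N <= n)%N -> forall k, `|s n - s (n + k)%N| < e.
  move=> e0; have [N hN] := geo qq M0 e0.
  by exists N => n Nn k; apply: le_lt_trans (sC _ _) (hN _ Nn).
have /cauchy_cvg/cvg_ex[b sb] : cauchy (s n @[n --> \oo]).
  apply: cauchy_exP => e e0; have [N hN] := small _ e0.
  exists (s N); exists N => // n /= Nn; rewrite -ball_normE /=.
  by rewrite -(subnKC Nn); apply: hN.
exists b.
  by apply: closed_cvg sb => //; apply: nearW.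
apply/eqP; rewrite -subr_eq0 -normr_le0; apply/ler_addgt0Pl => e e0.
rewrite addr0; have e20 : 0 < e / 2 by rewrite divr_gt0.
have [N _ hN] : \forall n \near \oo, `|s n - b| < e / 2.
  exact: cvgr_distC_lt sb _ e20.
have h1 := hN N.+1 (leqnSn _); have h0 := hN N (leqnn _).
have -> : b - (c + c ** b) = - (s N.+1 - b) + c ** (s N - b).
  by rewrite /= smulBr opprB addrA !opprD !addrA subrK.
apply: (le_trans (ler_normD _ _)); rewrite normrN (splitr e).
apply: lerD; first exact: ltW.
apply: (le_trans (cstar_normM _ _)); apply: le_trans (ltW h0).
by rewrite ler_piMl// ltW.
Qed.

Context (m : nat) (pi : B -> 'M[K]_m).
Hypothesis hpi : star_hom S pi.

(** If [|a| < |l|], let [c = l^-1 a] and [b = c + c ** b].  The homomorphism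
    carries this equation to matrices, where an [l]-eigenvector [v] of [pi a]
    satisfies [v (pi c) = v], so that [v (pi b) = v + v (pi b)] and [v = 0]. *)
Lemma eigenvalue_star_hom_le (a : B) (l : K) :
  S a -> eigenvalue (pi a) l -> `|l| <= `|a|.
Proof.
move=> Sa /eigenvalueP[v vl v0].
rewrite real_leNgt ?normr_real//; apply/negP => al.
have l0 : l != 0 by rewrite -normr_gt0 (le_lt_trans _ al).
have c1 : `|l^-1 *: a| < 1.
  by rewrite normrZ normfV mulrC ltr_pdivrMr ?mul1r// normr_gt0.
have Sc : S (l^-1 *: a) by apply: (star_subZ hS).
have [b Sb bE] := neumann_fixpoint Sc c1.
have vc : v *m pi (l^-1 *: a) = v.
  by rewrite (star_homZ hpi)// -scalemxAr vl scalerA mulVf// scale1r.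
have : v *m pi b = v + v *m pi b.
  rewrite {1}bE (star_homD hpi)//; last exact: (star_subM hS).
  by rewrite (star_homM hpi)// mulmxDr vc [pi _ ** _]/(_ *m _) mulmxA vc.
by rewrite -[LHS]add0r => /addIr/esym/eqP; rewrite (negPf v0).
Qed.

End automatic_continuity.

(** The trace is the sum of the roots of the characteristic polynomial. *)
Lemma norm_mxtrace_le (K : numClosedFieldType) (m : nat) (A : 'M[K]_m) (r : K) :
  (forall l, eigenvalue A l -> `|l| <= r) -> `|\tr A| <= m%:R * r.
Proof.
case: m A => [|m] A Ar; first by rewrite /mxtrace big_ord0 normr0 mul0r.
have [s sE] := closed_field_poly_normal (char_poly A).
rewrite (monicP (char_poly_monic A)) scale1r in sE.
have sz : size s = m.+1.
  by apply: succn_inj; rewrite -(size_prod_XsubC s id) -sE size_char_poly.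
have -> : \tr A = \sum_(l <- s) l.
  apply: oppr_inj; rewrite -char_poly_trace// -coefPn_prod_XsubC ?sz//.
  by rewrite sE.
apply: (le_trans (ler_norm_sum _ _ _)); rewrite -sz.
have : {in s, forall l, `|l| <= r}.
  by move=> l ls; apply: Ar; rewrite eigenvalue_root_char sE root_prod_XsubC.
elim: s {sE sz} => [|l s IH] sr; first by rewrite big_nil mul0r.
rewrite big_cons /= -nat1r mulrDl mul1r lerD ?IH ?sr ?mem_head// => k ks.
by rewrite sr// inE ks orbT.
Qed.

Section star_homs_into_matrices.
Context (K : numClosedFieldType).
Hypothesis geo : geometric_vanishing K.
Context (B : cstarAlgType K).

(** The squared absolute values of the entries of [pi a] add up to the trace of
    [pi (star a ** a)], whose eigenvalues are at most [|a|^2]. *)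
Lemma star_hom_entry_le (S : set B) (m : nat) (pi : B -> 'M[K]_m) (a : B) p q :
  star_subalgebra S -> closed S -> star_hom S pi -> S a ->
  `|pi a p q| <= m%:R * `|a|.
Proof.
move=> hS cS hpi Sa.
have Saa : S (star a ** a).
  by apply: (star_subM hS) => //; apply: (star_subS hS).
have traceE : \tr (pi (star a ** a)) = \sum_i \sum_k `|pi a k i| ^+ 2.
  rewrite (star_homM hpi)//; last exact: (star_subS hS).
  rewrite (star_homS hpi)//; apply: eq_bigr => i _; rewrite mxE.
  by apply: eq_bigr => k _; rewrite !mxE mulrC -normCK.
have sq0 i k : 0 <= `|pi a k i| ^+ 2 by rewrite exprn_ge0.
have le_tr : `|pi a p q| ^+ 2 <= \tr (pi (star a ** a)).
  rewrite traceE (bigD1 q)//= (bigD1 p)//= -addrA lerDl addr_ge0//.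
    by rewrite sumr_ge0.
  by rewrite sumr_ge0// => i _; rewrite sumr_ge0.
have : `|\tr (pi (star a ** a))| <= m%:R * `|a| ^+ 2.
  rewrite -cstar_norm; apply: norm_mxtrace_le => l.
  exact: (eigenvalue_star_hom_le geo hS cS hpi Saa).
have tr0 : 0 <= \tr (pi (star a ** a)) by apply: le_trans le_tr.
rewrite ger0_norm// => /(le_trans le_tr) h.
rewrite -(ler_pXn2r (n := 2))// ?nnegrE ?mulr_ge0// exprMn.
apply: (le_trans h); rewrite ler_wpM2r ?exprn_ge0// -natrX ler_nat.
by case: (m) => // k; rewrite -{1}[k.+1]expn1 leq_pexp2l.
Qed.

(** Where the two homomorphisms agree is a star-subalgebra, and it is closed
    because both are continuous. *)
Lemma eq_star_hom_cstar_generated (G : set B) (m : nat) (pi rho : B -> 'M[K]_m) :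
  star_hom (cstar_generated G) pi -> star_hom (cstar_generated G) rho ->
  {in G, pi =1 rho} -> {in cstar_generated G, pi =1 rho}.
Proof.
move=> hpi hrho eqG a; rewrite inE => Ga.
pose C := cstar_generated G; pose S := [set b | C b /\ pi b = rho b].
have hC : star_subalgebra C by exact: cstar_generated_star_subalgebra.
have cC : closed C by exact: cstar_generated_closed.
suff /(_ a Ga)[] : C `<=` S by [].
apply: cstar_generated_min.
- split=> [|b c [Cb bE] [Cc cE]|l b [Cb bE]|b c [Cb bE] [Cc cE]|b [Cb bE]].
  + split; first exact: (star_sub0 hC).
    have C0 := star_sub0 hC.
    rewrite -[0 in LHS]subr0 -[0 in RHS]subr0.
    by rewrite (star_homB hC hpi)// (star_homB hC hrho)// !subrr.
  + by split; [apply: (star_subD hC)|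
      rewrite (star_homD hpi)// (star_homD hrho)// bE cE].
  + by split; [apply: (star_subZ hC)|
      rewrite (star_homZ hpi)// (star_homZ hrho)// bE].
  + by split; [apply: (star_subM hC)|
      rewrite (star_homM hpi)// (star_homM hrho)// bE cE].
  + by split; [apply: (star_subS hC)|
      rewrite (star_homS hpi)// (star_homS hrho)// bE].
- move=> b clb.
  have Cb : C b by apply: cC; apply: (closure_subset _ clb) => c [].
  split=> //; apply/matrixP => p q; apply/eqP; rewrite -subr_eq0 -normr_le0.
  apply/ler_addgt0Pl => e e0; rewrite addr0.
  have m0 : 0 < (m%:R + m%:R + 1 : K) by rewrite ltr_wpDl// addr_ge0.
  have d0 : 0 < e / (m%:R + m%:R + 1) by rewrite divr_gt0.
  have [c [[Cc cE]]] := clb _ (nbhsx_ballx b _ d0).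
  rewrite -ball_normE /= ltr_pdivlMr// => bc.
  have Cbc : C (b - c) by exact: (star_subB hC).
  have -> : pi b p q - rho b p q = pi (b - c) p q - rho (b - c) p q.
    rewrite (star_homB hC hpi)// (star_homB hC hrho)// cE !mxE.
    by rewrite opprB addrA subrK.
  apply: (le_trans (ler_normB _ _)); apply: le_trans (ltW bc).
  rewrite mulrDr mulr1 mulrDr ler_wpDr// mulrC.
  by rewrite lerD// (star_hom_entry_le p q hC cC).
- move=> b Gb; split; first exact: sub_cstar_generated.
  by apply: eqG; rewrite inE.
Qed.
End star_homs_into_matrices.

(** * Block diagonal matrices *)

Section block_diagonal.
Context (t : nat) (r : 'I_t -> nat).

Lemma mxdiag_Rank (V : nmodType) (D : forall k, 'M[V]_(r k)) k i i' :
  (\mxdiag_k D k) (tagnat.Rank k i) (tagnat.Rank k i') = D k i i'.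
Proof. by have /matrixP/(_ i i') := submxblock_diag D k; rewrite mxE. Qed.

Lemma mxdiag_Rank_neq (V : nmodType) (D : forall k, 'M[V]_(r k)) k k' i i' :
  k != k' -> (\mxdiag_k D k) (tagnat.Rank k i) (tagnat.Rank k' i') = 0.
Proof.
move=> kk'.
have /matrixP/(_ i i') : submxblock (\mxdiag_k D k) k k' = 0.
  by rewrite mxblockK (negPf kk').
by rewrite !mxE.
Qed.

Context (K : numClosedFieldType).
Implicit Types D E : forall k, 'M[K]_(r k).

Lemma mul_mxdiag D E : \mxdiag_k (D k *m E k) = \mxdiag_k D k *m \mxdiag_k E k.
Proof.
rewrite [X in _ *m X]/mxdiag mul_mxdiag_mxblock; apply/eq_mxblock => i k.
by case: eqVneq => [<-|]; rewrite ?conform_mx_id ?mulmx0.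
Qed.

Lemma scale_mxdiag (c : K) D : \mxdiag_k (c *: D k) = c *: \mxdiag_k D k.
Proof.
rewrite -mul_scalar_mx -mxdiagZ -mul_mxdiag.
by apply: eq_mxdiag => k; rewrite mul_scalar_mx.
Qed.

Lemma map_mxdiag (f : {additive K -> K}) D :
  \mxdiag_k map_mx f (D k) = map_mx f (\mxdiag_k D k).
Proof.
apply/matrixP => p q; rewrite [RHS]mxE -(tagnat.sig2K p) -(tagnat.sig2K q).
have [e|ne] := eqVneq (tagnat.sig1 p) (tagnat.sig1 q).
  move: (tagnat.sig2 p) (tagnat.sig2 q); rewrite e => i i'.
  by rewrite !mxdiag_Rank mxE.
by rewrite !mxdiag_Rank_neq// raddf0.
Qed.

Lemma star_hom_mxdiag (B : starAlgType K) (S : set B) (m : nat)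
    (e : (\sum_k r k)%N = m) (pi : forall k, B -> 'M[K]_(r k)) :
  (forall k, star_hom S (pi k)) ->
  star_hom S (fun a => castmx (e, e) (\mxdiag_k pi k a)).
Proof.
move=> hpi; case: m / e; split => [a b Sa Sb|c a Sa|a b Sa Sb|a Sa];
  rewrite !castmx_id.
- by rewrite -mxdiagD; apply: eq_mxdiag => k; rewrite (star_homD (hpi k)).
- by rewrite -scale_mxdiag; apply: eq_mxdiag => k; rewrite (star_homZ (hpi k)).
- apply: etrans (mul_mxdiag _ _).
  by apply: eq_mxdiag => k; rewrite (star_homM (hpi k)).
- rewrite [RHS]/star /= tr_mxdiag -map_mxdiag.
  by apply: eq_mxdiag => k; rewrite (star_homS (hpi k)).
Qed.

(** Block [k] occupies the indices [start k + i] with [i < r k], so a matrix can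
    be compared with a block diagonal one through plain arithmetic on indices. *)
Lemma castmx_mxdiagP (V : nmodType) m (e : (\sum_k r k)%N = m)
    (D : forall k, 'M[V]_(r k)) (A : 'M[V]_m) (start : 'I_t -> nat) :
  (forall k, start k = \sum_(i < t | (i < k)%N) r i)%N ->
  (forall k (i i' : 'I_(r k)) (p q : 'I_m),
     p = (start k + i)%N :> nat -> q = (start k + i')%N :> nat ->
     A p q = D k i i') ->
  (forall k k' (i : 'I_(r k)) (i' : 'I_(r k')) (p q : 'I_m), k != k' ->
     p = (start k + i)%N :> nat -> q = (start k' + i')%N :> nat ->
     A p q = 0) ->
  A = castmx (e, e) (\mxdiag_k D k).
Proof.
move=> startE; case: m / e A => A eqD eq0; rewrite castmx_id.
apply/matrixP => p q.
have := tagnat.rect p; have := tagnat.rect q; rewrite -!startE.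
have -> : (\mxdiag_k D k) p q =
    (\mxdiag_k D k) (tagnat.Rank (tagnat.sig1 p) (tagnat.sig2 p))
                     (tagnat.Rank (tagnat.sig1 q) (tagnat.sig2 q)).
  by rewrite !tagnat.sig2K.
have [e|ne] := eqVneq (tagnat.sig1 p) (tagnat.sig1 q).
  move: (tagnat.sig2 p) (tagnat.sig2 q); rewrite e => i i' qE pE.
  by rewrite mxdiag_Rank; apply: eqD.
by move=> qE pE; rewrite mxdiag_Rank_neq//; apply: eq0 ne pE qE.
Qed.

End block_diagonal.

(** * Itineraries of first returns *)

Section itinerary.
Context (X : topologicalType).

Lemma closure_bigcup_ord n (F : 'I_n -> set X) x :
  closure (\bigcup_(i in [set: 'I_n]) F i) x -> exists i, closure (F i) x.
Proof.
move=> clx; apply: contrapT => /forallNP nF.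
have : \forall y \near x, forall i, ~ F i y.
  apply: filter_forall => i; have /existsNP[U /not_implyP[Ux FU]] := nF i.
  by near=> y => Fy; apply: FU; exists y; split => //; near: y.
by move=> /clx[y [[i _ Fy]]] /(_ i).
Unshelve. all: by end_near. Qed.

Lemma closure_image (f : X -> X) (E : set X) x :
  continuous f -> closure E x -> closure (f @` E) (f x).
Proof.
by move=> cf clx U /cf/clx[y [Ey Uy]]; exists (f y); split; first exists y.
Qed.

Lemma continuous_iter n (f : X -> X) : continuous f -> continuous (iter n f).
Proof.
move=> cf; elim: n => [|n IH] x /=; first exact: cvg_id.
exact: (continuous_comp (IH x) (cf _)).
Qed.

Context (sigma : X -> X) (Y : set X).
Hypothesis csigma : continuous sigma.

Lemma first_return n z : Y z -> (0 < n)%N -> Y (iter n sigma z) ->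
  exists2 r, (r <= n)%N & return_level sigma Y r z.
Proof.
move=> Yz n0 Yn; pose P r := (0 < r)%N && `[< Y (iter r sigma z) >].
have exP : exists r, P r by exists n; rewrite /P n0; apply/asboolP.
case: (ex_minnP exP) => r /andP[r0 /asboolP Yr] rmin.
exists r; first by apply: rmin; rewrite /P n0; apply/asboolP.
split=> // m /andP[m0 mr] Ym.
have : (r <= m)%N by apply: rmin; rewrite /P m0; apply/asboolP.
by rewrite leqNgt mr.
Qed.

(** An itinerary lists successive first return times to [Y].  The one of a point
    [z] of [E] varies with [z], but its first entry takes finitely many values,
    so that [x] is in the closure of the points of [E] sharing one value [r];
    apply [sigma^r] and repeat.  Thus [x] inherits one fixed itinerary, with
    closures of return levels in place of the levels; its own first return
    times may well be shorter. *)
Lemma closure_itinerary n (E : set X) x : closure E x ->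
  (forall z, E z -> Y z /\ Y (iter n sigma z)) ->
  exists s : seq nat, sumn s = n /\
    forall k, (k < size s)%N ->
      closure (return_level sigma Y (nth 0%N s k))
        (iter (sumn (take k s)) sigma x).
Proof.
elim/ltn_ind: n E x => n IH E x clE EY.
have [->|n0] := posnP n; first by exists [::].
pose F (r : 'I_n.+1) := E `&` return_level sigma Y r.
have /closure_bigcup_ord[r clF] : closure (\bigcup_(r in setT) F r) x.
  apply: closure_subset clE => z Ez; have [Yz Yn] := EY _ Ez.
  have [r rn Rr] := first_return Yz n0 Yn.
  by exists (Ordinal (rn : (r < n.+1)%N)).
have [_ [[_ [_ r0 _ _]] _]] := clF setT filterT.
have rn : (r <= n)%N by rewrite -ltnS.
have rn' : (n - r < n)%N by rewrite ltn_subrL r0.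
have [||s [sE sY]] := IH _ rn' (iter r sigma @` F r) (iter r sigma x).
- by apply: closure_image clF; apply: continuous_iter.
- move=> _ [z [Ez [_ _ Yr _]] <-]; split=> //.
  by rewrite -iterD subnK//; have [] := EY _ Ez.
exists (nat_of_ord r :: s); split; first by rewrite /= sE subnKC.
move=> [_|k ks]/=; first by apply: closure_subset clF => z [].
by rewrite addnC iterD; apply: sY.
Qed.

(** The same itinerary, indexed like the blocks of a block diagonal matrix. *)
Lemma closure_itinerary_ord n (E : set X) x : closure E x ->
  (forall z, E z -> Y z /\ Y (iter n sigma z)) ->
  exists t (r : 'I_t -> nat), (\sum_k r k)%N = n /\
    forall k, closure (return_level sigma Y (r k))
        (iter (\sum_(i < t | (i < k)%N) r i) sigma x).
Proof.
move=> clE /(closure_itinerary clE)[s [<- sY]].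
exists (size s), (fun k => nth 0%N s k); split.
  by rewrite sumnE (big_nth 0%N) big_mkord.
move=> k; have kt := ltnW (ltn_ord k).
rewrite (big_ord_narrow kt) /=.
suff -> : (\sum_(i < k) nth 0 s i = sumn (take k s))%N by apply: sY.
rewrite sumnE (big_nth 0%N) big_mkord size_takel//.
by apply: eq_bigr => i _; rewrite nth_take.
Qed.

End itinerary.

(** * Orbit segments cut into blocks *)

Section blocks.
Context (t : nat) (r : 'I_t -> nat).
Local Notation start k := (\sum_(i < t | (i < k)%N) r i)%N.

Lemma ltn_block_start (k k' : 'I_t) (i : 'I_(r k)) :
  (k < k')%N -> (start k + i < start k')%N.
Proof.
move=> kk'; rewrite [ltnRHS](bigD1 k)//= addnC -addSn leq_add//.
rewrite big_mkcond [leqRHS]big_mkcond; apply: leq_sum => l _.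
case: ltnP => // lk; rewrite (ltn_trans lk kk') /=.
by rewrite -val_eqE /= (ltn_eqF lk).
Qed.

Lemma ltn_block (k k' : 'I_t) (i : 'I_(r k)) (i' : 'I_(r k')) :
  (k < k')%N -> (start k + i < start k' + i')%N.
Proof. by move=> /(ltn_block_start i)/leq_trans; apply; rewrite leq_addr. Qed.

(** A subdiagonal entry lies outside the diagonal blocks only in the first row
    of a block. *)
Lemma succ_block_eq_start (k k' : 'I_t) (i : 'I_(r k)) (i' : 'I_(r k')) :
  k != k' -> (start k + i = (start k' + i').+1 -> start k + i = start k)%N.
Proof.
rewrite -val_eqE neq_ltn => /orP[] kk' e.
  by have := ltn_block i i' kk'; rewrite e ltnNge leqnSn.
by apply/eqP; rewrite eqn_leq leq_addr andbT e ltn_block_start.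
Qed.

End blocks.

Section first_return_blocks.
Context (K : numClosedFieldType) (X : topologicalType) (sigma : X -> X).
Context (t : nat) (r : 'I_t -> nat) (x : X) (m : nat).
Hypothesis e : (\sum_k r k)%N = m.
Local Notation start k := (\sum_(i < t | (i < k)%N) r i)%N.

Lemma mxdiag_orbit_fun (f : X -> K^o) :
  diag_mx (\row_(p < m) f (iter p.+1 sigma x)) =
  castmx (e, e) (\mxdiag_(k < t) diag_mx
    (\row_(p < r k) f (iter p.+1 sigma (iter (start k) sigma x)))).
Proof.
apply: (@castmx_mxdiagP _ _ _ _ _ _ _ (fun k => start k))
  => // [k i i'|k k' i i'] p q.
  move=> pE qE; rewrite !mxE -!val_eqE /= pE qE eqn_add2l.
  by rewrite -iterD (addnC i).
move=> kk' pE qE; rewrite !mxE -!val_eqE /= pE qE; case: eqP => // pq.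
exfalso; move/eqP: pq; move: kk'.
rewrite -val_eqE neq_ltn => /orP[] /ltn_block h.
  by rewrite (ltn_eqF (h r i i')).
by rewrite (gtn_eqF (h r i' i)).
Qed.

(** The subdiagonal entries lost by cutting into blocks are the
    [g (sigma^(start k) x)]; for the itineraries above these points are in [Y],
    where [g] vanishes. *)
Lemma mxdiag_orbit_shift (g : X -> K^o) :
  (forall k : 'I_t, g (iter (start k) sigma x) = 0) ->
  (\matrix_(p < m, q < m)
     (if p == q.+1 :> nat then g (iter q.+1 sigma x) else 0)) =
  castmx (e, e) (\mxdiag_(k < t) \matrix_(p < r k, q < r k)
    (if p == q.+1 :> nat
     then g (iter q.+1 sigma (iter (start k) sigma x)) else 0)).
Proof.
move=> g0.
apply: (@castmx_mxdiagP _ _ _ _ _ _ _ (fun k => start k))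
  => // [k i i'|k k' i i'] p q.
  move=> pE qE; rewrite !mxE /= pE qE -addnS eqn_add2l.
  by rewrite -iterD (addnC (nat_of_ord i')).
move=> kk' pE qE; rewrite !mxE; case: eqP => // pq.
by rewrite -pq pE (succ_block_eq_start (i' := i') kk' _) // -pE pq qE.
Qed.

End first_return_blocks.

(** * The inclusion of orbit breaking algebras *)

Section inclusion.
Context (K : numClosedFieldType).
Hypothesis geo : geometric_vanishing K.
Context (X : topologicalType) (sigma : X -> X) (B : cstarAlgType K)
  (j : (X -> K^o) -> B) (u : B).

Lemma orbit_breakingS (Y Z : set X) :
  Z `<=` Y -> orbit_breaking j u Y `<=` orbit_breaking j u Z.
Proof.
move=> ZY; apply: cstar_generated_min.
- exact: cstar_generated_star_subalgebra.
- exact: cstar_generated_closed.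
- move=> b [jb|[g [cg g0] <-]]; apply: sub_cstar_generated; first by left.
  by right; exists g => //; split=> // y /ZY/g0.
Qed.

Context (Y Z : set X).
Hypotheses (csigma : continuous sigma) (cY : closed Y) (ZY : Z `<=` Y).
Context (lY : nat) (nY : 'I_lY -> nat)
  (iotaY : B -> mfsum K (return_space sigma Y nY) nY)
  (hY : is_presentation j u iotaY)
  (lZ : nat) (nZ : 'I_lZ -> nat)
  (iotaZ : B -> mfsum K (return_space sigma Z nZ) nZ)
  (hZ : is_presentation j u iotaZ).
Arguments iotaY : clear implicits.
Arguments iotaZ : clear implicits.
Local Notation AY := (orbit_breaking j u Y).
Local Notation AZ := (orbit_breaking j u Z).

(** The points that diagonalize the evaluation at [x]: those of the orbit of [x]
    at the partial sums of an itinerary, each in the closure of the return level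
    that its block size prescribes. *)
Lemma return_blocks i (x : return_space sigma Z nZ i) :
  exists t (w : 'I_t -> {i : 'I_lY & return_space sigma Y nY i}),
    (\sum_k nY (tag (w k)))%N = nZ i /\
    forall k, set_val (tagged (w k)) =
      iter (\sum_(i < t | (i < k)%N) nY (tag (w i))) sigma (set_val x).
Proof.
have xcl : closure (return_level sigma Z (nZ i)) (set_val x).
  exact: set_valP.
have [|t [r [rE rY]]] := closure_itinerary_ord (Y := Y) csigma (n := nZ i) xcl.
  by move=> z [Zz _ Zn _]; split; apply: ZY.
have [_ nYE] := pres_times hY.
have /choice[w wP] : forall k, exists w : {i & return_space sigma Y nY i},
    r k = nY (tag w) /\ set_val (tagged w) =
      iter (\sum_(i < t | (i < k)%N) r i) sigma (set_val x).
  move=> k; have rk := rY k.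
  have : range nY (r k).
    rewrite nYE; have [y [Ry _]] := rk setT filterT.
    by exists y.
  move=> [l _ lE]; rewrite -lE in rk.
  pose y : return_space sigma Y nY l := SigSub (mem_set rk).
  by exists (Tagged (return_space sigma Y nY) y).
have rw : r = fun k => nY (tag (w k)) by apply/funext => k; case: (wP k).
by exists t, w; rewrite rw in rE wP; split=> // k; case: (wP k).
Qed.

Lemma return_space_sub l (n : 'I_l -> nat) i (y : return_space sigma Y n i) :
  Y (set_val y).
Proof.
by apply: cY; apply: closure_subset (set_valP y) => z [].
Qed.

(** Both sides are star-homomorphisms of [AY] into matrices, so only the
    generators [j f] and [u ** j g] need to be compared. *)
Lemma eval_diagonal i (x : return_space sigma Z nZ i) :
  exists t (w : 'I_t -> {i : 'I_lY & return_space sigma Y nY i})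
    (e : (\sum_k nY (tag (w k)))%N = nZ i),
  forall b, AY b -> iotaZ b i x =
    castmx (e, e) (\mxdiag_k iotaY b (tag (w k)) (tagged (w k))).
Proof.
have [t [w [e wE]]] := return_blocks x; exists t, w, e => b AYb.
pose rho k b : 'M[K]_(nY (tag (w k))) := iotaY b (tag (w k)) (tagged (w k)).
have hrho k : star_hom AY (rho k) by apply: star_hom_eval (pres_hom hY).
have hpi : star_hom AY (fun b => iotaZ b i x : 'M[K]_(nZ i)).
  apply: star_hom_eval; apply: star_hom_sub (pres_hom hZ).
  exact: orbit_breakingS.
have := eq_star_hom_cstar_generated geo hpi (star_hom_mxdiag e hrho).
apply; last by rewrite inE.
move=> {AYb} {}b; rewrite inE => -[[f cf <-]|[g [cg g0] <-]].
  rewrite (pres_fun hZ)// (mxdiag_orbit_fun _ _ e); congr castmx.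
  by apply: eq_mxdiag => k; rewrite /rho (pres_fun hY)// wE.
rewrite (pres_shift hZ)//; last by move=> y /ZY/g0.
rewrite (mxdiag_orbit_shift e); last first.
  by move=> k /=; rewrite -wE; apply: g0; apply: return_space_sub.
congr castmx.
by apply: eq_mxdiag => k; rewrite /rho (pres_shift hY)// wE.
Qed.

Lemma inclusion_diagonal_map
  (phi : mfsum K (return_space sigma Y nY) nY ->
         mfsum K (return_space sigma Z nZ) nZ) :
  (forall a, AY a -> phi (iotaY a) = iotaZ a) ->
  diagonal_map (iotaY @` AY) (iotaZ @` AZ) phi.
Proof.
move=> hphi; have sYZ := orbit_breakingS ZY.
have hA : star_subalgebra AY by exact: cstar_generated_star_subalgebra.
have [iY iZ] := (pres_hom hY, pres_hom hZ).
split.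
- by move=> _ [a Aa <-]; exists a; [exact: sYZ|rewrite hphi].
- split=> [_ _ [a Aa <-] [b Ab <-]|c _ [a Aa <-]|_ _ [a Aa <-] [b Ab <-]
          |_ [a Aa <-]].
  + rewrite -(star_homD iY)// !hphi//; last exact: (star_subD hA).
    by rewrite (star_homD iZ)//; exact: sYZ.
  + rewrite -(star_homZ iY)// !hphi//; last exact: (star_subZ hA).
    by rewrite (star_homZ iZ)//; exact: sYZ.
  + rewrite -(star_homM iY)// !hphi//; last exact: (star_subM hA).
    by rewrite (star_homM iZ)//; exact: sYZ.
  + rewrite -(star_homS iY)// !hphi//; last exact: (star_subS hA).
    by rewrite (star_homS iZ)//; exact: sYZ.
- move=> i x; have [t [w [e wE]]] := eval_diagonal x.
  by exists t, w, e; split=> // _ [a Aa <-]; rewrite hphi// wE.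
Qed.

End inclusion.

Unset Implicit Arguments.

Theorem lemma1p5 (R : realType) (X : topologicalType)
  (hX_compact : compact [set: X]) (hX_haus : hausdorff_space X)
  (hX_inf : infinite_set [set: X])
  (sigma sigmaV : X -> X) (hsigma : homeomorphism sigma sigmaV)
  (hmin : minimal_map sigma)
  (Y Z : set X) (hY : closure_of_open Y) (hZ : closure_of_open Z)
  (hZY : Z `<=` Y)
  (B : cstarAlgType (Cplx R)) (j : (X -> (Cplx R)^o) -> B) (u : B)
  (hB : is_crossed_product sigmaV j u)
  (lY : nat) (nY : 'I_lY -> nat)
  (iotaY : B -> mfsum (Cplx R) (return_space sigma Y nY) nY)
  (hiotaY : is_presentation j u iotaY)
  (lZ : nat) (nZ : 'I_lZ -> nat)
  (iotaZ : B -> mfsum (Cplx R) (return_space sigma Z nZ) nZ)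
  (hiotaZ : is_presentation j u iotaZ)
  (phi : mfsum (Cplx R) (return_space sigma Y nY) nY ->
         mfsum (Cplx R) (return_space sigma Z nZ) nZ)
  (hphi : forall a, orbit_breaking j u Y a -> phi (iotaY a) = iotaZ a) :
  diagonal_map (iotaY @` orbit_breaking j u Y)
               (iotaZ @` orbit_breaking j u Z) phi.
Proof.
have [U [_ _ YU]] := hY.
have cY : closed Y by rewrite YU; exact: closed_closure.
exact: (inclusion_diagonal_map (@geometric_vanishing_Cplx R)
  (homeo_cont hsigma) cY hZY hiotaY hiotaZ hphi).
Qed.
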